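(* Let $k\ge 1$ be an integer and let $\mathcal{C}=\frac{2\pi k}{2k+1}$. If $X\subseteq S^1$ satisfies $\mathrm{diam}(X)<\mathcal{C}$, then the convex hull $\mathrm{conv}(\mathrm{SM}_{2k}(X))$ does not contain the origin $\vec{0}\in\mathbb{R}^{2k}$. This bound is sharp: the statement fails if $\mathcal{C}$ is replaced by any larger number.
   Context: The circle $S^1=\mathbb{R}/2\pi\mathbb{Z}$ carries the geodesic metric of total circumference $2\pi$, and $\mathrm{diam}$ is taken with respect to it. The centrally symmetric moment curve $\mathrm{SM}_{2k}\colon S^1\to\mathbb{R}^{2k}$ is $$\mathrm{SM}_{2k}(t)=\bigl(\cos t,\sin t,\cos 3t,\sin 3t,\ldots,\cos((2k-1)t),\sin((2k-1)t)\bigr).$$ $\mathrm{conv}(Y)$ denotes the convex hull of $Y$. *)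

(* Defs.v *)
From HB Require Import structures.
From mathcomp Require Import all_boot all_order all_algebra.
From mathcomp Require Import all_classical all_reals all_analysis.
From mathcomp Require Import lra.

Set Implicit Arguments.
Unset Strict Implicit.
Unset Printing Implicit Defensive.

Import Order.TTheory GRing.Theory Num.Theory.

Local Open Scope classical_set_scope.
Local Open Scope quotient_scope.
Local Open Scope ring_scope.

Definition twopiZ (R : realType) : {pred R} :=
  fun t => `[< exists n : int, t = n%:~R * (2 * pi) >].

Lemma twopiZ_zmod_closed (R : realType) : zmod_closed (@twopiZ R).
Proof.
split=> [|s t /asboolP[m ->] /asboolP[n ->]].
  by apply/asboolP; exists 0; rewrite mul0r.
by apply/asboolP; exists (m - n); rewrite intrB mulrBl.
Qed.

HB.instance Definition _ (R : realType) :=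
  GRing.isZmodClosed.Build R (@twopiZ R) (@twopiZ_zmod_closed R).

Definition circle (R : realType) : Type := Quotient.quot (@twopiZ R).

HB.instance Definition _ (R : realType) := GRing.Zmodule.on (circle R).
HB.instance Definition _ (R : realType) :=
  EqQuotient.on (circle R).

Lemma circle_eqP (R : realType) (s t : R) :
  \pi_(circle R) s = \pi_(circle R) t <->
  exists n : int, s = t + n%:~R * (2 * pi).
Proof.
rewrite (rwP eqP) -(@Quotient.idealrBE R (@twopiZ R)).
split=> [/asboolP[n st]|[n ->]]; first by exists n; rewrite -st addrC subrK.
by apply/asboolP; exists n; rewrite addrAC subrr add0r.
Qed.

(* The quotient metric: the length of a shortest arc joining x and y. *)
Definition geod_dist (R : realType) (x y : circle R) : R :=
  inf [set r : R | exists s t : R,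
    [/\ \pi_(circle R) s = x, \pi_(circle R) t = y & r = `|s - t|]].

(* Distances are bounded by pi (geod_dist_le_pi), so for X nonempty this is a
   genuine supremum; the diameter of the empty set is 0. *)
Definition diam (R : realType) (X : set (circle R)) : R :=
  sup [set r : R | exists x y, [/\ X x, X y & r = geod_dist x y]].

(* On an arc of length at most pi the metric is the one of the real line. *)
Lemma geod_dist_pi (R : realType) (s t : R) : `|s - t| <= pi ->
  geod_dist (\pi_(circle R) s) (\pi_(circle R) t) = `|s - t|.
Proof.
move=> st.
rewrite /geod_dist; set D := (X in inf X).
have Dst : D `|s - t| by exists s, t.
have lbD : lbound D `|s - t|.
  move=> _ [s' [t' [/circle_eqP[m ->] /circle_eqP[n ->] ->]]].
  rewrite opprD addrACA -mulrBl -intrB.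
  have [->|mn] := eqVneq (m - n) 0; first by rewrite mul0r addr0.
  have mn1 : 1 <= `|(m - n)%:~R : R|.
    by rewrite -intr_norm -[1]/(1%:~R) ler_int -gtz0_ge1 normr_gt0.
  rewrite (le_trans st)// -(opprK ((m - n)%:~R * _)) distrC.
  rewrite (le_trans _ (lerB_dist _ _))// normrN normrM.
  rewrite (ger0_norm (_ : 0 <= 2 * pi)) ?mulr_ge0 ?pi_ge0// lerBrDr.
  rewrite (le_trans (lerD (lexx pi) st))// -mulr2n -[leLHS]mulr_natl.
  by rewrite ler_peMl// mulr_ge0 ?pi_ge0.
apply/le_anti/andP; split.
  by apply: ge_inf => //; exists `|s - t|.
by apply: lb_le_inf => //; exists `|s - t|.
Qed.

Lemma geod_dist_ge0 (R : realType) (x y : circle R) : 0 <= geod_dist x y.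
Proof.
apply: lb_le_inf => [|_ [s [t [_ _ ->]]]]; last exact: normr_ge0.
by exists `|repr x - repr y|, (repr x), (repr y); rewrite !reprK.
Qed.

Lemma geod_dist_le_pi (R : realType) (x y : circle R) : geod_dist x y <= pi.
Proof.
set u := repr x - repr y; pose n := Num.floor (u / (2 * pi) + 2^-1).
have pi2 : 0 < 2 * pi :> R by rewrite mulr_gt0 ?pi_gt0.
have un : `|repr x - (repr y + n%:~R * (2 * pi))| <= pi.
  rewrite opprD addrA -/u.
  have /andP[] := floor_itv (u / (2 * pi) + 2^-1).
  rewrite -/n intrD => n1 n2.
  have e : u / (2 * pi) * (2 * pi) = u by rewrite divfK// gt_eqF.
  have h : 2^-1 * (2 * pi) = pi :> R by rewrite mulrA mulVf ?mul1r.
  move: n1 n2; rewrite -(ler_pM2r pi2) -(ltr_pM2r pi2).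
  rewrite (mulrDl (u / _)) e h.
  rewrite (mulrDl n%:~R 1%:~R) mul1r => n1 n2.
  by rewrite ler_norml; lra.
have -> : y = \pi_(circle R) (repr y + n%:~R * (2 * pi)).
  by rewrite -[LHS]reprK; apply/circle_eqP; exists (- n); rewrite intrN mulNr addrK.
by rewrite -{1}[x]reprK geod_dist_pi.
Qed.

(* Coordinates 2i and 2i + 1, counted from 0, have frequency m = 2i + 1. *)
Definition SM_lift (R : realType) (k : nat) (t : R) : 'rV[R]_(2 * k) :=
  \row_(j < 2 * k)
    let m := (j./2).*2.+1 in
    if odd j then sin (m%:R * t) else cos (m%:R * t).

(* Evaluating at the chosen representative is harmless, see SM_pi. *)
Definition SM (R : realType) (k : nat) (x : circle R) : 'rV[R]_(2 * k) :=
  SM_lift k (repr x).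

Lemma SM_pi (R : realType) (k : nat) (t : R) :
  SM k (\pi_(circle R) t) = SM_lift k t.
Proof.
have per (f : R -> R) : periodic f (pi *+ 2) ->
    forall (n : int) u, f (u + n%:~R * (pi *+ 2)) = f u.
  move=> pf [n|n] u; first by rewrite mulr_natl (periodicn pf).
  rewrite -(periodicn pf n.+1) NegzE intrN mulNr [_%:~R * _]mulr_natl.
  by rewrite subrK.
have /circle_eqP[n e] := reprK (\pi_(circle R) t).
apply/rowP => j; rewrite !mxE e; set m := _.*2.+1; cbv zeta.
have -> : m%:R * (t + n%:~R * (2 * pi)) =
    m%:R * t + (m%:Z * n)%:~R * (pi *+ 2).
  by rewrite mulrDr mulrA intrM -[pi *+ 2]mulr_natl.
by case: ifP => _; rewrite per//; [exact: sinD2pi|exact: cosD2pi].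
Qed.

Definition conv_hull (R : realType) (n : nat) (Y : set 'rV[R]_n) : set 'rV[R]_n :=
  smallest (@convex_set R 'rV[R]_n) Y.

(* Main.v *)
(* If diam X < C, every point of X is at distance at least d > pi / (2k + 1)
   from every point of -X.  Hence X and -X alternate at most 2k times along a
   half circle from a point of X to its antipode, and in fact at most 2k - 1
   times, since the number of alternations is odd.  Cutting at c_1, ..., c_r
   between consecutive alternations, the function prod_i sin (c_i - t) is
   positive on X; having odd degree r <= 2k - 1, it is a linear functional of
   SM_2k(t), which separates conv (SM_2k (X)) from 0.  For sharpness, the regular
   (2k + 1)-gon has diameter C, and 0 is the mean of its image. *)

Require Import Defs.
From mathcomp Require Import all_boot all_order all_algebra.
From mathcomp Require Import all_classical all_reals all_analysis.
From mathcomp Require Import lra ring zify.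

Set Implicit Arguments.
Unset Strict Implicit.
Unset Printing Implicit Defensive.

Import Order.TTheory GRing.Theory Num.Theory.
Local Open Scope classical_set_scope.
Local Open Scope quotient_scope.
Local Open Scope ring_scope.

(** * Trigonometric polynomials with odd frequencies *)

Section RakedPolynomials.
Context {R : realType}.
Implicit Types (f g : R -> R) (k : nat).

(** These are the trigonometric polynomials with frequencies 1, 3, ..., 2k - 1; the coefficient
    vector [w] will define a separating half-space. *)
Definition raked k f :=
  exists w : 'cV[R]_(2 * k), forall t, (SM_lift k t *m w) 0 0 = f t.

Lemma raked_ext k f g : f =1 g -> raked k f -> raked k g.
Proof. by move=> fg [w wf]; exists w => t; rewrite wf fg. Qed.

Lemma rakedD k f g : raked k f -> raked k g -> raked k (fun t => f t + g t).
Proof.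
by move=> [v vf] [w wg]; exists (v + w) => t; rewrite mulmxDr mxE vf wg.
Qed.

Lemma rakedZ k a f : raked k f -> raked k (fun t => a * f t).
Proof.
by move=> [w wf]; exists (a *: w) => t; rewrite -scalemxAr mxE wf.
Qed.

Lemma raked_sum k (I : Type) (r : seq I) (F : I -> R -> R) :
  (forall i, raked k (F i)) -> raked k (fun t => \sum_(i <- r) F i t).
Proof.
move=> rF; elim: r => [|i r IHr].
  by exists 0 => t; rewrite mulmx0 mxE big_nil.
by apply: raked_ext (rakedD (rF i) IHr) => t; rewrite big_cons.
Qed.

Lemma raked_coord k (j : 'I_(2 * k)) : raked k (fun t => SM_lift k t 0 j).
Proof. by exists (delta_mx j 0) => t; rewrite -colE !mxE. Qed.

Lemma raked_cos k i e : (i < k)%N ->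
  raked k (fun t => cos ((i.*2.+1)%:R * t + e)).
Proof.
move=> ik.
have i0 : (i.*2 < 2 * k)%N by lia.
have i1 : (i.*2.+1 < 2 * k)%N by lia.
apply: raked_ext (rakedD (rakedZ (cos e) (raked_coord (Ordinal i0)))
  (rakedZ (- sin e) (raked_coord (Ordinal i1)))) => t.
rewrite !mxE /= odd_double /= doubleK uphalf_double cosD; ring.
Qed.

(* By linearity, it suffices to multiply the atoms of f, written with a phase to
   treat sines and cosines at once. *)
Lemma raked_mul k k' f g :
  (forall i e, (i < k)%N ->
     raked k' (fun t => cos ((i.*2.+1)%:R * t + e) * g t)) ->
  raked k f -> raked k' (fun t => f t * g t).
Proof.
move=> cosg [w wf].
have coordg (j : 'I_(2 * k)) : raked k' (fun t => SM_lift k t 0 j * g t).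
  have jk : (j./2 < k)%N by have := ltn_ord j; lia.
  case: (boolP (odd j)) => oj.
    apply: raked_ext (cosg _ (- (pi / 2)) jk) => t.
    by rewrite mxE oj cosBpihalf.
  by apply: raked_ext (cosg _ 0 jk) => t; rewrite mxE (negbTE oj) addr0.
apply: raked_ext (raked_sum (index_enum 'I_(2 * k))
  (fun j => rakedZ (w j 0) (coordg j))) => t.
rewrite -wf mxE mulr_suml; apply: eq_bigr => j _; ring.
Qed.

Lemma raked_leq k k' f : (k <= k')%N -> raked k f -> raked k' f.
Proof.
move=> kk' rf; apply: (raked_ext _ (raked_mul (g := fun=> 1) _ rf)) => [t|i e ik].
  by rewrite mulr1.
apply: raked_ext (raked_cos e (leq_trans ik kk')) => t.
by rewrite mulr1.
Qed.

Lemma cosM (x y : R) : cos x * cos y = (cos (x + y) + cos (x - y)) / 2.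
Proof. by rewrite !cosD cosN sinN; field. Qed.

(** The product of the two sines has frequencies 0 and 2 only, so it shifts an odd frequency by -2,
    0 or 2 and keeps it odd. *)
Lemma raked_cos_mul2 k i e a b : (i < k)%N ->
  raked k.+1 (fun t => cos ((i.*2.+1)%:R * t + e) * (sin (a - t) * sin (b - t))).
Proof.
move=> ik.
have lower : raked k.+1
    (fun t => cos ((i.*2.+1)%:R * t - 2 * t + (e + (a + b - pi)))).
  (* For i = 0 the frequency -1 is turned into 1 by parity of cos. *)
  case: i ik => [_|i ik].
    apply: raked_ext (raked_cos (i := 0) (- (e + (a + b - pi))) (ltn0Sn k)) => t.
    by rewrite -cosN; congr cos; rewrite double0; ring.
  have ik' : (i < k.+1)%N by lia.
  apply: raked_ext (raked_cos (e + (a + b - pi)) ik') => t.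
  by congr cos; rewrite doubleS -addn2 natrD; ring.
have upper : raked k.+1
    (fun t => cos ((i.*2.+1)%:R * t + 2 * t + (e - (a + b - pi)))).
  apply: raked_ext (raked_cos (k := k.+1) (i := i.+1) (e - (a + b - pi)) ik) => t.
  by congr cos; rewrite doubleS -addn2 natrD; ring.
apply: raked_ext (rakedD (rakedZ (cos (a - b) / 2) (raked_cos e (leqW ik)))
  (rakedZ (4^-1) (rakedD lower upper))) => t.
rewrite -(cosBpihalf (a - t)) -(cosBpihalf (b - t)).
rewrite [cos (a - t - _) * _]cosM.
set m := (i.*2.+1)%:R.
have -> : a - t - pi / 2 - (b - t - pi / 2) = a - b :> R by ring.
have -> : a - t - pi / 2 + (b - t - pi / 2) = a + b - pi - 2 * t :> R by field.
have := cosM (m * t + e) (a + b - pi - 2 * t).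
have -> : m * t + e + (a + b - pi - 2 * t) =
    m * t - 2 * t + (e + (a + b - pi)) by ring.
have -> : m * t + e - (a + b - pi - 2 * t) =
    m * t + 2 * t + (e - (a + b - pi)) by ring.
by lra.
Qed.

(** Sines are multiplied in two at a time, starting from a single one, which is a cosine of
    frequency 1 with a phase. *)
Lemma raked_prod_sin k j (cs : seq R) : size cs = j.*2.+1 -> (j < k)%N ->
  raked k (fun t => \prod_(c <- cs) sin (c - t)).
Proof.
move=> scs jk; apply: (raked_leq jk); elim: j cs scs {jk} => [|j IHj] cs.
  case: cs => [|c []] //= _.
  apply: raked_ext (raked_cos (pi / 2 - c) (ltnSn 0)) => t.
  rewrite big_seq1 -cosBpihalf -[RHS]cosN double0; congr cos; ring.
case: cs => [|a [|b cs]] //= [scs].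
apply: (raked_ext _ (raked_mul _ (IHj cs scs))) => [t|i e ij].
  by rewrite !big_cons mulrA mulrC.
exact: raked_cos_mul2.
Qed.

End RakedPolynomials.

(** * Products with prescribed signs on an interval *)

Section Cuts.
Context {R : realType}.
Implicit Types (A B : set R) (u v d : R) (cs : seq R).

(* The first cut is put at a distance d / 2 below the infimum b of B above u:
   a point of B lies arbitrarily close to b, so A avoids ]b - d, b + d[ and the
   induction goes on from b with A and B exchanged. *)
Lemma separating_cuts n A B u v d : 0 < d ->
  (forall a b, A a -> B b -> d <= `|a - b|) ->
  (forall b, B b -> u <= b -> u + d <= b) ->
  v < u + n.+1%:R * d ->
  exists cs, [/\ (size cs <= n)%N, {in cs, forall c, u < c < v} &
    forall t, u <= t <= v -> (A t -> 0 < \prod_(c <- cs) (c - t)) /\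
                            (B t -> \prod_(c <- cs) (c - t) < 0)].
Proof.
move=> d0; elim: n A B u => [|n IHn] A B u AB Bu uv.
  (* Here [v < u + d], so [B] misses [u, v], and the empty product is positive. *)
  exists [::]; split=> // t /andP[ut tv]; rewrite big_nil; split=> // Bt.
  by have := Bu _ Bt ut; lra.
have [[b1 [Bb1 ub1 b1v]]|noB] := pselect (exists b, [/\ B b, u <= b & b <= v]);
  last first.
  exists [::]; split=> // t /andP[ut tv]; rewrite big_nil; split=> // Bt.
  by case: noB; exists t.
pose S := [set b | [/\ B b, u <= b & b <= v]].
have S0 : S !=set0 by exists b1.
have lbS : lbound S (u + d) by move=> b [Bb ub _]; exact: Bu.
have le_inf b : S b -> inf S <= b.
  by move=> Sb; apply: ge_inf => //; exists (u + d).
have uS : u + d <= inf S by exact: lb_le_inf.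
have Sv : inf S <= v by exact: le_trans (le_inf _ (And3 Bb1 ub1 b1v)) b1v.
have AS a : A a -> a <= inf S - d \/ inf S + d <= a.
  move=> Aa; have [aS|Sa] := leP a (inf S - d); first by left.
  right; rewrite leNgt; apply/negP => aS.
  have [|b Sb ba] := @inf_lt _ S (a + d) S0; first by lra.
  have := le_inf _ Sb; case: Sb => Bb _ _.
  by have := AB _ _ Aa Bb; rewrite ler_normr => /orP[]; lra.
have [||| cs [scs csv pcs]] := IHn B A (inf S).
- by move=> b a Bb Aa; rewrite distrC; exact: AB.
- by move=> a /AS[]//; lra.
- by move: uv; rewrite -natr1 mulrDl mul1r; lra.
exists (inf S - d / 2 :: cs); split=> //.
  move=> c; rewrite inE => /orP[/eqP->|/csv]; first by apply/andP; split; lra.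
  by move=> /andP[? ->]; rewrite andbT; lra.
move=> t /andP[ut tv]; rewrite big_cons.
have [tS|St] := ltP t (inf S); last first.
  (* From [inf S] on, the factor of the new cut is negative, which undoes the exchange of [A] and
     [B]. *)
  have [|posB negA] := pcs t; first by rewrite St tv.
  split=> [/negA|/posB] sgn; first by rewrite nmulr_rgt0//; lra.
  by rewrite nmulr_rlt0//; lra.
split=> [At|Bt]; last first.
  by have := le_inf t (And3 Bt ut tv); rewrite leNgt tS.
apply: mulr_gt0; first by case: (AS _ At); lra.
rewrite big_seq; apply: prodr_gt0 => c /csv /andP[]; lra.
Qed.

Lemma prodN_seq cs (F : R -> R) :
  \prod_(c <- cs) - F c = (-1) ^+ size cs * \prod_(c <- cs) F c.
Proof.
elim: cs => [|c cs IH]; first by rewrite !big_nil mulr1.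
by rewrite !big_cons IH exprS; ring.
Qed.

Lemma sgr_sin (x : R) : `|x| < pi -> Num.sg (sin x) = Num.sg x.
Proof.
rewrite ltr_norml => /andP[x1 x2].
case: (ltrgtP x 0) => [x0|x0|->]; last by rewrite sin0.
  rewrite (ltr0_sg x0) ltr0_sg// -oppr_gt0 -sinN sin_gt0_pi//; lra.
by rewrite (gtr0_sg x0) gtr0_sg// sin_gt0_pi// x0.
Qed.

(** Each [c - t] stays in ]-pi, pi[, where sine has the sign of its argument; this transfers the
    linear cuts to products of sines. *)
Lemma sgr_prod_sin u t cs : u <= t < u + pi ->
  {in cs, forall c, u < c < u + pi} ->
  Num.sg (\prod_(c <- cs) sin (c - t)) = Num.sg (\prod_(c <- cs) (c - t)).
Proof.
move=> /andP[ut tu] ucs; rewrite big_seq [in RHS]big_seq.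
apply: (big_ind2 (fun x y => Num.sg x = Num.sg y)) => // [x1 x2 y1 y2 e1 e2|c].
  by rewrite !sgrM e1 e2.
move=> /ucs/andP[uc cu]; apply: sgr_sin; rewrite ltr_norml.
by apply/andP; split; lra.
Qed.

End Cuts.

(** * Separating the convex hull from the origin *)

Section Separation.
Context {R : realType}.
Implicit Types X : set (circle R).

Lemma pi_circleDn (t : R) (n : int) :
  \pi_(circle R) (t + n%:~R * (2 * pi)) = \pi_(circle R) t.
Proof. by apply/circle_eqP; exists n. Qed.

Lemma geod_dist_le_diam X x y : X x -> X y -> geod_dist x y <= diam X.
Proof.
move=> Xx Xy; apply: ub_le_sup; last by exists x, y.
by exists pi => _ [x' [y' [_ _ ->]]]; exact: geod_dist_le_pi.
Qed.

(** Here [t] represents the antipode of a point of [X], and replacing a point by its antipode turns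
    a distance r into pi - r. *)
Lemma antipodal_gap X (s t : R) :
  X (\pi_(circle R) s) -> X (\pi_(circle R) (t + pi)) ->
  pi - diam X <= `|s - t|.
Proof.
move=> Xs Xt; rewrite leNgt; apply/negP => st.
have pi0 := pi_gt0 R.
have D0 := le_trans (geod_dist_ge0 _ _) (geod_dist_le_diam Xs Xt).
move: st; rewrite ltr_norml => /andP[st1 st2].
have [le_st|lt_ts] := leP s t.
  (* One more turn brings the difference with [t + pi] into [0, pi], where [geod_dist_pi]
     applies. *)
  have Xs' : X (\pi_(circle R) (s + (1 : int)%:~R * (2 * pi))).
    by rewrite pi_circleDn.
  have := geod_dist_le_diam Xs' Xt.
  have e : `|s + (1 : int)%:~R * (2 * pi) - (t + pi)| = s - t + pi.
    by rewrite ger0_norm; lra.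
  by rewrite geod_dist_pi e; lra.
have := geod_dist_le_diam Xs Xt.
have e : `|s - (t + pi)| = pi - (s - t) by rewrite ler0_norm; lra.
by rewrite geod_dist_pi e; lra.
Qed.

Lemma circle_lift (u : R) (x : circle R) :
  exists2 s, u <= s < u + 2 * pi & \pi_(circle R) s = x.
Proof.
pose n := Num.floor ((repr x - u) / (2 * pi)).
have p2 : 0 < 2 * pi :> R by rewrite mulr_gt0 ?pi_gt0.
exists (repr x + (- n)%:~R * (2 * pi)); last by rewrite pi_circleDn reprK.
have /andP[] := floor_itv ((repr x - u) / (2 * pi)).
rewrite -/n ler_pdivlMr// ltr_pdivrMr// intrD intrN mulrDl mulNr mul1r.
by move=> h1 h2; apply/andP; split; lra.
Qed.

(** The bound on [diam X] says that a half turn is shorter than 2k + 1 gaps of length [pi - diam X],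
    as [separating_cuts] requires for at most 2k cuts. *)
Lemma positive_raked k X : (1 <= k)%N ->
  pi < (2 * k).+1%:R * (pi - diam X) ->
  exists2 f : R -> R, raked k f & forall t, X (\pi_(circle R) t) -> 0 < f t.
Proof.
move=> k1 hd.
have [X0|noX] := pselect (exists u, X (\pi_(circle R) u)); last first.
  exists (fun=> 0); first by exists 0 => t; rewrite mulmx0 mxE.
  by move=> t Xt; case: noX; exists t.
have [u Xu] := X0; have pi0 := pi_gt0 R.
pose A := [set t | X (\pi_(circle R) t)].
pose B := [set t | X (\pi_(circle R) (t + pi))].
have d0 : 0 < pi - diam X.
  by rewrite -(@pmulr_rgt0 _ (2 * k).+1%:R) ?ltr0n//; lra.
have AB a b : A a -> B b -> pi - diam X <= `|a - b| by exact: antipodal_gap.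
have [|| cs [scs csv pcs]] := @separating_cuts _ (2 * k) A B u (u + pi) _ d0 AB.
- by move=> b Bb ub; have := AB _ _ Xu Bb; rewrite ler0_norm; lra.
- by lra.
have Bv : B (u + pi).
  rewrite /B /=; have -> : u + pi + pi = u + (1 : int)%:~R * (2 * pi) by ring.
  by rewrite pi_circleDn.
(* At [u + pi], which lies in [B], all factors are negative and so is their product. *)
have ocs : odd (size cs).
  have [|_ /(_ Bv)] := pcs (u + pi); first by apply/andP; split; lra.
  apply: contraTT => ecs; rewrite -leNgt.
  under eq_bigr do rewrite -opprB.
  rewrite prodN_seq -signr_odd (negbTE ecs) mul1r big_seq; apply: prodr_ge0.
  by move=> c /csv /andP[]; lra.
have rf : raked k (fun t => \prod_(c <- cs) sin (c - t)).
  by apply: (@raked_prod_sin _ _ (size cs)./2); lia.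
exists (fun t => \prod_(c <- cs) sin (c - t)) => // t Xt.
have [w wE] := rf.
have [s /andP[us su] st] := circle_lift u (\pi_(circle R) t).
(* The product factors through [SM], hence takes the same value at [t] and at its representative
   [s]. *)
rewrite -wE -SM_pi -st SM_pi wE.
have [s_lt|s_ge] := ltP s (u + pi).
  rewrite -sgr_cp0 (@sgr_prod_sin _ u) ?us// sgr_cp0.
  by apply: (pcs s _).1; rewrite ?us ?ltW// /A /= st.
(* On the second half turn, [s - pi] lies in [B], where the product is negative; a shift by pi
   changes the sign of each of the oddly many sines. *)
have -> : \prod_(c <- cs) sin (c - s) = - \prod_(c <- cs) sin (c - (s - pi)).
  have -> : - \prod_(c <- cs) sin (c - (s - pi)) =
      \prod_(c <- cs) - sin (c - (s - pi)).
    by rewrite prodN_seq -signr_odd ocs mulN1r.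
  by apply: eq_bigr => c _; rewrite opprB addrA addrAC sinDpi opprK.
rewrite oppr_gt0 -sgr_cp0 (@sgr_prod_sin _ u) ?sgr_cp0//;
  last by apply/andP; split; lra.
apply: (pcs (s - pi) _).2; first by apply/andP; split; lra.
by rewrite /B /= subrK st.
Qed.

(** The coefficients of [f] define an open half-space that contains the image of [X], hence its
    hull, but not 0. *)
Lemma conv_hull_raked k X (f : R -> R) :
  raked k f -> (forall t, X (\pi_(circle R) t) -> 0 < f t) ->
  ~ conv_hull (@SM R k @` X) 0.
Proof.
move=> [w wf] f0.
pose P : set 'rV[R]_(2 * k) := [set v | 0 < (v *m w) 0 0].
have cP : convex_set P.
  move=> v1 v2 l; rewrite !inE /P /= => v1P v2P.
  rewrite /conv/= mulmxDl -!scalemxAl mxE [X in X + _]mxE [X in _ + X]mxE.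
  exact: (convR_gt0 l v1P v2P).
move=> /(smallest_sub cP) h.
have : P 0.
  apply: h => _ [x Xx <-]; rewrite /P /= -[x]reprK SM_pi wf.
  by apply: f0; rewrite reprK.
by rewrite /P /= mul0mx mxE ltxx.
Qed.

End Separation.

(** * Sharpness: regular polygons *)

Section RegularPolygon.
Context {R : realType}.

(** By induction, combining the last point, with weight 1 / (N + 2), and the mean of the others. *)
Lemma conv_hull_mean n (Y : set 'rV[R]_n) N (v : nat -> 'rV[R]_n) :
  (forall i, (i <= N)%N -> Y (v i)) ->
  conv_hull Y (N.+1%:R^-1 *: \sum_(0 <= i < N.+1) v i).
Proof.
move=> + C [cC YC]; elim: N => [|N IH] Yv.
  by rewrite big_nat1 invr1 scale1r; exact: YC (Yv _ _).
have {}IH : C _ := IH (fun i iN => Yv i (leqW iN)).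
have l0 : 0 <= N.+2%:R^-1 :> R by rewrite invr_ge0.
have l1 : N.+2%:R^-1 <= 1 :> R by rewrite invf_le1 ?ler1n.
have := cC (v N.+1) _ (Itv01 l0 l1) (mem_set (YC _ (Yv _ (leqnn _))))
  (mem_set IH).
rewrite inE; congr (C _).
rewrite [in RHS]big_nat_recr// scalerDr [RHS]addrC; congr (_ + _).
rewrite /conv/= scalerA; congr (_ *: _).
have : N.+1%:R + 1 != 0 :> R by rewrite natr1 pnatr_eq0.
have : N.+1%:R != 0 :> R by rewrite pnatr_eq0.
transitivity ((1 - N.+2%:R^-1) * N.+1%:R^-1 : R) => //.
by rewrite -[N.+2%:R]natr1; field; apply/andP.
Qed.

(** As for the Dirichlet kernel, multiplying by [sin h] makes the sum telescope. *)
Lemma sum_cos_ap (h e : R) N :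
  sin h * \sum_(0 <= j < N) cos (j%:R * (2 * h) + e) =
  sin (N%:R * h) * cos (N%:R * h - h + e).
Proof.
elim: N => [|N IH]; first by rewrite big_nil mul0r sin0 mul0r mulr0.
rewrite big_nat_recr//= mulrDr IH -[N.+1%:R]natr1.
set x := N%:R * h.
have -> : (N%:R + 1) * h = x + h by rewrite /x; ring.
have -> : N%:R * (2 * h) + e = x + (x + e) by rewrite /x; ring.
have -> : x - h + e = (x + e) - h by ring.
have -> : x + h - h + e = x + e by ring.
rewrite (cosD (x + e) (- h)) cosN sinN (cosD x (x + e)) (sinD x h); ring.
Qed.

Lemma sin_natpi n : sin (n%:R * pi) = 0 :> R.
Proof.
by rewrite mulr_natl -[_ *+ n]add0r (alternatingn (@sinDpi R)) sin0 mulr0.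
Qed.

(** For h = m pi / N in ]0, pi[, [sin h] is nonzero whereas sin (N h) = sin (m pi) = 0. *)
Lemma sum_cos_polygon m N (e : R) : (0 < m < N)%N ->
  \sum_(0 <= j < N) cos (m%:R * (j%:R * (2 * pi / N%:R)) + e) = 0.
Proof.
move=> /andP[m0 mN]; pose h : R := m%:R * pi / N%:R.
have N0 : 0 < N%:R :> R by rewrite ltr0n; lia.
have h0 : 0 < h by rewrite divr_gt0// mulr_gt0 ?ltr0n ?pi_gt0.
have hpi : h < pi by rewrite ltr_pdivrMr// mulrC ltr_pM2l ?pi_gt0// ltr_nat.
have sh : sin h != 0 by rewrite gt_eqF// sin_gt0_pi// h0.
apply: (mulfI sh); rewrite mulr0.
under eq_bigr => j _.
  rewrite (_ : m%:R * _ = j%:R * (2 * h)); last by rewrite /h; ring.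
  over.
rewrite sum_cos_ap (_ : N%:R * h = m%:R * pi) ?sin_natpi ?mul0r//.
by rewrite /h mulrC divfK// gt_eqF.
Qed.

Definition polygon N : set (circle R) :=
  [set \pi_(circle R) (j%:R * (2 * pi / N%:R)) | j in [set j : nat | (j < N)%N]].

Lemma conv_hull_polygon k : conv_hull (@SM R k @` polygon (2 * k).+1) 0.
Proof.
pose v j := SM_lift k (j%:R * (2 * pi / (2 * k).+1%:R)) : 'rV[R]_(2 * k).
have /(_ (2 * k)%N) := @conv_hull_mean _ (@SM R k @` polygon (2 * k).+1) ^~ v.
rewrite (_ : \sum_(0 <= j < _) _ = 0) ?scaler0.
  apply=> j jk; exists (\pi_(circle R) (j%:R * (2 * pi / (2 * k).+1%:R))).
    by exists j.
  exact: SM_pi.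
apply/rowP => j; rewrite summxE mxE.
(* Every frequency is positive and below the number of vertices, so each coordinate sums to 0. *)
have mk : (0 < (j./2).*2.+1 < (2 * k).+1)%N by have := ltn_ord j; lia.
under eq_bigr do rewrite mxE /=.
case: (odd j).
  under eq_bigr do rewrite -cosBpihalf.
  exact: sum_cos_polygon.
by under eq_bigr do rewrite -[X in cos X]addr0; exact: sum_cos_polygon.
Qed.

Lemma geod_dist_le (s t : R) :
  geod_dist (\pi_(circle R) s) (\pi_(circle R) t) <= `|s - t|.
Proof.
apply: ge_inf; last by exists s, t.
by exists 0 => _ [? [? [_ _ ->]]]; exact: normr_ge0.
Qed.

Lemma diam_polygon k :
  diam (polygon (2 * k).+1) <= 2 * pi * k%:R / (2 * k).+1%:R.
Proof.
have pi0 := pi_gt0 R; have N0 : 0 < (2 * k).+1%:R :> R by rewrite ltr0n.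
have [x x0] : polygon (2 * k).+1 !=set0 by eexists; exists 0%N.
apply: ge_sup; first by exists (geod_dist x x), x, x.
move=> _ [_ [_ [[i /= iN <-] [j /= jN <-] ->]]].
have -> : 2 * pi * k%:R / (2 * k).+1%:R =
    k%:R * (2 * pi / (2 * k).+1%:R) :> R by ring.
set c := 2 * pi / _.
have c0 : 0 <= c by rewrite divr_ge0 ?ler0n//; lra.
have Nc : (2 * k).+1%:R * c = 2 * pi by rewrite mulrC divfK// gt_eqF.
(* Adding [n] turns shifts the index [i] by n (2k + 1); some [n] among -1, 0, 1 brings the index
   difference into [-k, k]. *)
have near_le n : `|i%:R + n%:~R * (2 * k).+1%:R - j%:R| <= k%:R :> R ->
    geod_dist (\pi_(circle R) (i%:R * c)) (\pi_(circle R) (j%:R * c)) <= k%:R * c.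
  move=> nk; rewrite -(pi_circleDn _ n); apply: le_trans (geod_dist_le _ _) _.
  rewrite -Nc [n%:~R * _]mulrA -mulrDl -mulrBl normrM (ger0_norm c0).
  exact: ler_wpM2r.
have NE : (2 * k).+1%:R = 2 * k%:R + 1 :> R by rewrite -natr1 natrM.
have i0 := ler0n R i; have j0 := ler0n R j; have k0 := ler0n R k.
have [ij|ji] := leqP i (j + k); last first.
  have ik : (i <= 2 * k)%N by lia.
  apply: (near_le (-1)); rewrite ler_norml NE; move: ji ik.
  by rewrite -(addn1 (j + k)) -!(ler_nat R) natrM !natrD; lra.
have [ji|ij'] := leqP j (i + k); last first.
  have jk : (j <= 2 * k)%N by lia.
  apply: (near_le 1); rewrite ler_norml NE; move: ij' jk.
  by rewrite -(addn1 (i + k)) -!(ler_nat R) natrM !natrD; lra.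
apply: (near_le 0); rewrite ler_norml; move: ij ji.
by rewrite -!(ler_nat R) !natrD; lra.
Qed.

End RegularPolygon.

Theorem theorem5 (R : realType) (k : nat) (hk : (1 <= k)%N) :
  let C : R := (2 * pi * k%:R) / (2 * k%:R + 1) in
  (forall X : set (circle R), diam X < C -> ~ conv_hull (@SM R k @` X) 0) /\
  (forall C' : R, C < C' ->
    ~ (forall X : set (circle R),
         diam X < C' -> ~ conv_hull (@SM R k @` X) 0)).
Proof.
move=> C.
have N0 : 0 < (2 * k).+1%:R :> R by rewrite ltr0n.
have NE : (2 * k).+1%:R = 2 * k%:R + 1 :> R by rewrite -natr1 natrM.
have CE : C = 2 * pi * k%:R / (2 * k).+1%:R by rewrite /C NE.
split=> [X XC|C' CC' h].
  have [|f rf f0] := @positive_raked R k X hk; last exact: conv_hull_raked rf f0.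
  have : (2 * k).+1%:R * diam X < 2 * pi * k%:R.
    by rewrite mulrC -ltr_pdivlMr// -CE.
  by have pi0 := pi_gt0 R; rewrite mulrBr NE; lra.
apply: (h (@polygon R (2 * k).+1)); last exact: conv_hull_polygon.
by apply: le_lt_trans (diam_polygon k) _; rewrite -CE.
Qed.
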